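(* Let $p$ be a prime, let $E$ be an elementary abelian $p$-group of rank $r \geq 2$, and let $M$ be a finite abelian $p$-group with an effective action of $E$ by group automorphisms. If $M$ is cohomologically trivial as an $E$-module, then: (1) $M$ is not cyclic; (2) $M$ is not isomorphic to $\mathbb{Z}/p^k \times \mathbb{Z}/p$ for any $k \geq 2$; (3) $M$ is not isomorphic to $(\mathbb{Z}/p)^k$ unless $k$ is a multiple of $p^r$; (4) if $p = 2$, then $M$ is not isomorphic to $\mathbb{Z}/4 \times \mathbb{Z}/4$.
   Context: An action is effective if it is faithful, i.e. only the identity acts trivially. A $\mathbb{Z}E$-module $M$ is cohomologically trivial if the Tate cohomology groups $\hat{H}^n(H;M)$ vanish for all $n \in \mathbb{Z}$ and all subgroups $H \leq E$. *)

(* Defs.v *)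
From HB Require Import structures.
From mathcomp Require Import all_boot all_order all_algebra all_fingroup.
From mathcomp Require Import all_solvable zify.

Set Implicit Arguments.
Unset Strict Implicit.
Unset Printing Implicit Defensive.

Import GRing.Theory FinRing.Theory.

Local Open Scope ring_scope.

(* The library puts a Zmodule and a Finite structure on {ffun I -> M}, but not
   their join, nor the additive group seen as a finGroupType. *)
HB.instance Definition _ (I : finType) (M : finZmodType) :=
  Finite.on {ffun I -> M}.
HB.instance Definition _ (I : finType) (M : finZmodType) :=
  [finGroupMixin of {ffun I -> M} for +%R].

(* Tate cohomology of a subgroup H of a finite group E with coefficients in a
   finite E-module M, computed by the complete standard complex
     ... -> F_1 -> F_0 -> F_0^* -> F_1^* -> ...,   F_q = Z[H^(q+1)],
   where F_(q+1) -> F_q is the alternating sum of the face maps,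
   F_q^* -> F_(q+1)^* is its dual, and F_0 -> F_0^* is the composite of the
   augmentation with its dual.  F_q is placed in degree q and F_q^* in degree
   -q-1, so that, F_q^* being identified with Z[H^(q+1)] by means of the dual
   basis, the n-cochains Hom_H(-, M) are the equivariant functions H^(n+1) -> M
   for n >= 0 and the equivariant functions H^(-n) -> M for n < 0.
   In accordance with the library's convention for actions, modules are right
   modules: (to x a) is x acted upon by a, and H acts on the right on H^(q+1). *)
Section TateCohomology.

Variables (E : finGroupType) (M : finZmodType).
Variables (to : groupAction [set: E] [set: M]) (H : {group E}).

Local Notation G := (subg_of H).
Local Notation tup q := {ffun 'I_q -> G}.
Local Notation cochain q := {ffun tup q -> M}.

Definition face q (t : tup q.+1) (i : 'I_q.+1) : tup q :=
  [ffun j => t (lift i j)].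

Definition insertion q (t : tup q) (i : 'I_q.+1) (a : G) : tup q.+1 :=
  [ffun j => oapp t a (unlift i j)].

Definition translate q (t : tup q) (a : G) : tup q := [ffun j => (t j * a)%g].

Definition equivariant q : {set cochain q} :=
  [set f : cochain q |
    [forall t, forall a, f (translate t a) == to (f t) (sgval a)]].

(* From degree q to degree q+1. *)
Definition diff_pos q (f : cochain q.+1) : cochain q.+2 :=
  [ffun t => \sum_(i < q.+2) f (face t i) *~ (-1) ^+ i].

(* From degree -1 to degree 0. *)
Definition diff_norm (f : cochain 1) : cochain 1 := [ffun=> \sum_t f t].

(* From degree -q-2 to degree -q-1. *)
Definition diff_neg q (f : cochain q.+2) : cochain q.+1 :=
  [ffun t => \sum_(i < q.+2) \sum_a f (insertion t i a) *~ (-1) ^+ i].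

(* Negz q is the integer -q-1. *)
Definition tate_arity (n : int) : nat :=
  match n with Posz q => q.+1 | Negz q => q.+1 end.

Definition tate_cocycles (n : int) : {set cochain (tate_arity n)} :=
  match n return {set cochain (tate_arity n)} with
  | Posz q      => [set f in equivariant q.+1 | diff_pos f == 0]
  | Negz 0      => [set f in equivariant 1    | diff_norm f == 0]
  | Negz q'.+1  => [set f in equivariant q'.+2 | diff_neg f == 0]
  end.

Definition tate_coboundaries (n : int) : {set cochain (tate_arity n)} :=
  match n return {set cochain (tate_arity n)} with
  | Posz 0     => diff_norm @: equivariant 1
  | Posz q'.+1 => @diff_pos q' @: equivariant q'.+1
  | Negz q     => @diff_neg q @: equivariant q.+2
  end.

Definition tate_cohomology (n : int) : {set coset_of (tate_coboundaries n)} :=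
  (tate_cocycles n / tate_coboundaries n)%g.

Definition endo (a : E) (x : M) : M := to x a.

Fact endo_zmod a : zmod_morphism (endo a).
Proof.
have endoD : {morph endo a : x y / x + y}.
  by move=> x y; rewrite /endo -!zmodMgE gactM ?inE.
move=> x y; apply: (addIr (endo a y)).
by rewrite subrK -endoD subrK.
Qed.
HB.instance Definition _ a :=
  GRing.isZmodMorphism.Build M M (endo a) (endo_zmod a).

Lemma equivariantP q (f : cochain q) :
  reflect (forall t a, f (translate t a) = endo (sgval a) (f t))
          (f \in equivariant q).
Proof.
rewrite inE; apply: (iffP 'forall_forallP) => h t a; first exact/eqP.
by rewrite h.
Qed.

Fact equivariant_group_set q : group_set (equivariant q).
Proof.
apply/group_setP; split=> [|f g /equivariantP hf /equivariantP hg].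
  by apply/equivariantP => t a; rewrite !ffunE raddf0.
by apply/equivariantP => t a; rewrite zmodMgE !ffunE hf hg raddfD.
Qed.
Canonical equivariant_group q := Group (equivariant_group_set q).

Fact diff_pos_zmod q : zmod_morphism (@diff_pos q).
Proof.
move=> f g; apply/ffunP=> t; rewrite !ffunE -sumrB.
by apply: eq_bigr => i _; rewrite !ffunE mulrzBl.
Qed.
HB.instance Definition _ q :=
  GRing.isZmodMorphism.Build _ _ (@diff_pos q) (@diff_pos_zmod q).

Fact diff_norm_zmod : zmod_morphism diff_norm.
Proof.
move=> f g; apply/ffunP=> t; rewrite !ffunE -sumrB.
by apply: eq_bigr => i _; rewrite !ffunE.
Qed.
HB.instance Definition _ :=
  GRing.isZmodMorphism.Build _ _ diff_norm diff_norm_zmod.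

Fact diff_neg_zmod q : zmod_morphism (@diff_neg q).
Proof.
move=> f g; apply/ffunP=> t; rewrite !ffunE -sumrB.
apply: eq_bigr => i _; rewrite -sumrB.
by apply: eq_bigr => a _; rewrite !ffunE mulrzBl.
Qed.
HB.instance Definition _ q :=
  GRing.isZmodMorphism.Build _ _ (@diff_neg q) (@diff_neg_zmod q).

Fact tate_cocycles_group_set n : group_set (tate_cocycles n).
Proof.
have ker q r (d : {additive cochain q -> cochain r}) :
    group_set [set f in equivariant q | d f == 0].
  apply/group_setP; split=> [|f g].
      by apply/setIdP; rewrite group1 raddf0.
  move=> /setIdP[hf /eqP df] /setIdP[hg /eqP dg]; apply/setIdP.
  by rewrite groupM // zmodMgE raddfD df dg addr0.
by case: n => [q|[|q]] /=; apply: ker.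
Qed.
Canonical tate_cocycles_group n := Group (tate_cocycles_group_set n).

Fact tate_coboundaries_group_set n : group_set (tate_coboundaries n).
Proof.
have im q r (d : {additive cochain q -> cochain r}) :
    group_set (d @: equivariant q).
  apply/group_setP; split=> [|_ _ /imsetP[f hf ->] /imsetP[g hg ->]].
    by apply/imsetP; exists 0; [exact: group1 | rewrite raddf0].
  by apply/imsetP; exists (f + g); [exact: groupM | rewrite raddfD].
by case: n => [[|q]|q] /=; apply: im.
Qed.
Canonical tate_coboundaries_group n := Group (tate_coboundaries_group_set n).

Fact alternating_sum0 (V : zmodType) (F : nat -> nat -> V) m :
    (forall i j, (i < j < m.+1)%N -> F j i = F i j.-1) ->
  \sum_(j < m.+1) \sum_(i < m) F j i *~ (-1) ^+ (i + j)%N = 0.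
Proof.
elim: m => [|m IHm] hF; first by rewrite big_ord1 big_ord0.
rewrite big_ord_recr /=.
under eq_bigr => j _ do rewrite big_ord_recr /=.
rewrite big_split /= {}IHm ?add0r => [|i j /andP[ij jm]]; last first.
  by apply: hF; rewrite ij ltnW.
rewrite -big_split big1 //= => i _.
have -> : F m.+1 i = F i m by apply: (hF i m.+1); rewrite ltn_ord ltnSn.
by rewrite addnS exprS mulN1r mulrNz addnC subrr.
Qed.

Fact diff_pos_equivariant q (f : cochain q.+1) :
  f \in equivariant q.+1 -> diff_pos f \in equivariant q.+2.
Proof.
move=> /equivariantP hf; apply/equivariantP=> t a.
rewrite !ffunE raddf_sum; apply: eq_bigr => i _; rewrite raddfMz /= -hf.
by congr (f _ *~ _); apply/ffunP => j; rewrite !ffunE.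
Qed.

Fact diff_norm_equivariant (f : cochain 1) :
  f \in equivariant 1 -> diff_norm f \in equivariant 1.
Proof.
move=> /equivariantP hf; apply/equivariantP=> t a.
rewrite !ffunE raddf_sum.
have trK q (b : G) : cancel (@translate q ^~ b) (@translate q ^~ b^-1%g).
  by move=> u; apply/ffunP => j; rewrite !ffunE mulgK.
rewrite (reindex_inj (can_inj (@trK 1 a))).
by apply: eq_bigr => u _; rewrite hf.
Qed.

Fact diff_neg_equivariant q (f : cochain q.+2) :
  f \in equivariant q.+2 -> diff_neg f \in equivariant q.+1.
Proof.
move=> /equivariantP hf; apply/equivariantP=> t a.
rewrite !ffunE raddf_sum; apply: eq_bigr => i _; rewrite raddf_sum.
rewrite (reindex_inj (mulIg a)); apply: eq_bigr => b _; rewrite raddfMz /= -hf.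
congr (f _ *~ _); apply/ffunP => j; rewrite !ffunE.
by case: unliftP => [k|] _ /=; rewrite ?ffunE.
Qed.

Fact insertion_id q (t : tup q) i a : insertion t i a i = a.
Proof. by rewrite ffunE unlift_none. Qed.

Fact insertion_lift q (t : tup q) i a j : insertion t i a (lift i j) = t j.
Proof. by rewrite ffunE liftK. Qed.

Fact sum_insertion q (f : cochain q.+1) i :
  \sum_t \sum_a f (insertion t i a) = \sum_u f u.
Proof.
rewrite pair_big /= [RHS](reindex (fun u => insertion u.1 i u.2)) //=.
exists (fun u => (face u i, u i)) => [[t a]|u] _ /=.
  rewrite insertion_id; congr (_, _); apply/ffunP => j.
  by rewrite ffunE insertion_lift.
apply/ffunP => j; case: (unliftP i j) => [k|] ->; last exact: insertion_id.
by rewrite insertion_lift ffunE.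
Qed.

Fact diff_posK q (f : cochain q.+1) : diff_pos (diff_pos f) = 0.
Proof.
apply/ffunP => t; rewrite !ffunE.
pose F j i := f (face (face t (inord j)) (inord i)).
rewrite -[RHS](@alternating_sum0 _ F q.+2) => [|i j /andP[ij jm]].
  apply: eq_bigr => j _; rewrite ffunE mulrz_suml; apply: eq_bigr => i _.
  by rewrite /F !inord_val exprD mulrzA.
congr (f _); apply/ffunP => k; rewrite !ffunE; congr (t _); apply/val_inj.
rewrite /= /bump !inordK; lia.
Qed.

Fact diff_pos_norm (f : cochain 1) : diff_pos (diff_norm f) = 0.
Proof.
apply/ffunP => t; rewrite !ffunE !big_ord_recl big_ord0 !ffunE /= addr0.
by rewrite expr0 expr1 mulrNz subrr.
Qed.

Fact diff_norm_neg (f : cochain 2) : diff_norm (diff_neg f) = 0.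
Proof.
apply/ffunP => t; rewrite !ffunE.
under eq_bigr => u _ do rewrite ffunE.
rewrite exchange_big /=.
under eq_bigr => i _ do
  (under eq_bigr => u _ do rewrite -mulrz_suml; rewrite -mulrz_suml).
under eq_bigr => i _ do rewrite sum_insertion.
by rewrite !big_ord_recl big_ord0 /= addr0 expr0 expr1 mulrNz subrr.
Qed.

Fact diff_negK q (f : cochain q.+3) : diff_neg (diff_neg f) = 0.
Proof.
apply/ffunP => t; rewrite !ffunE.
pose F i j := \sum_b \sum_a f (insertion (insertion t (inord j) b) (inord i) a).
rewrite -[RHS](@alternating_sum0 _ F q.+2) => [|i j /andP[ij jm]].
  rewrite [RHS]exchange_big; apply: eq_bigr => j _.
  under [LHS]eq_bigr => b _ do rewrite ffunE mulrz_suml.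
  rewrite [LHS]exchange_big; apply: eq_bigr => i _.
  rewrite /F !inord_val mulrz_suml; apply: eq_bigr => b _.
  by rewrite !mulrz_suml; apply: eq_bigr => a _; rewrite addnC exprD mulrzA.
rewrite /F exchange_big; apply: eq_bigr => a _; apply: eq_bigr => b _.
congr (f _); apply/ffunP => k.
case: (unliftP (inord j) k) => [k1|] ->.
  rewrite insertion_lift.
  case: (unliftP (inord i) k1) => [k2|] ->.
    rewrite insertion_lift.
    have -> : lift (inord j) (lift (inord i) k2)
           = lift (inord i) (lift (inord j.-1) k2) :> 'I_q.+3.
      by apply/val_inj; rewrite /= /bump !inordK; lia.
    by rewrite !insertion_lift.
  rewrite insertion_id.
  have -> : lift (inord j) (inord i) = inord i :> 'I_q.+3.
    by apply/val_inj; rewrite /= /bump !inordK; lia.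
  by rewrite insertion_id.
rewrite insertion_id.
have -> : inord j = lift (inord i) (inord j.-1) :> 'I_q.+3.
  by apply/val_inj; rewrite /= /bump !inordK; lia.
by rewrite insertion_lift insertion_id.
Qed.

Lemma tate_coboundaries_sub n : tate_coboundaries n \subset tate_cocycles n.
Proof.
case: n => [[|q]|[|q]] /=; apply/subsetP => _ /imsetP[f hf ->]; apply/setIdP.
- by rewrite diff_norm_equivariant // diff_pos_norm.
- by rewrite diff_pos_equivariant // diff_posK.
- by rewrite diff_neg_equivariant // diff_norm_neg.
- by rewrite diff_neg_equivariant // diff_negK.
Qed.

End TateCohomology.

Definition cohomologically_trivial (E : finGroupType) (M : finZmodType)
    (to : groupAction [set: E] [set: M]) : Prop :=
  forall (H : {group E}) (n : int), tate_cohomology to H n = 1%g.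

(* Main.v *)
From HB Require Import structures.
Require Import Defs.
From mathcomp Require Import all_boot all_order all_algebra all_fingroup.
From mathcomp Require Import all_solvable classfun.

Set Implicit Arguments.
Unset Strict Implicit.
Unset Printing Implicit Defensive.

(** The argument rests on degree 0: for every subgroup H of E, the fixed
    points M^H are exactly the norms N_H M, N_H x being the sum of the
    x^a for a in H (tate0_norm).  As N_(H x <h>) is N_H followed by N_<h>, this
    yields M^(H x <h>) = N_<h>(M^H) whenever h is not in H
    (norm_fixed_joing); everything follows from this relation.

    If such an h acted trivially on M^H, then N_<h> would be multiplication by
    p on M^H, and M^H = p M^H would vanish, whereas a p-group acting on a
    nonzero p-group has a nonzero fixed point.  So M^H is not contained in
    M^h (fixed_not_sub).  For independent g and h, M^g and M^h are therefore
    incomparable, which cannot happen in a cyclic p-group (not_cyclic).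

    Suppose that M[p] has order p^2, as in the second and fourth claims.  By
    counting an orbit, some g <> 1 acts trivially on M[p] (trivial_on_torsion),
    so that M[p] is contained in M^g = N_g M while N_g kills M[p].  If M/M[p]
    is cyclic, then so is N_g M, which is absurd (not_cyclic_mod_torsion).  If
    M is Z/4 x Z/4, orders force M^g = M[2] = ker N_g; an h independent of g
    moves M[2], so it has only one nonzero fixed point y in M[2], and a half
    of y is found to lie in M[2] (not_order16_exponent4).

    When p M = 0, N_<h> = (h - 1)^(p-1), because the coefficients of
    ((1 + T)^p - 1)/T other than the leading one are divisible by p.  The
    relation above then says that all Jordan blocks of h - 1 on M^H have size
    p, hence |M^H| = |M^(H x <h>)|^p (card_fixed_step) and by induction
    |M| = |M^E|^|E| (card_fixed); this is the freeness of M over F_p[E] in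
    numerical form, and gives the third claim. *)

(** * Kernels, images and nilpotent endomorphisms *)

Section AdditiveMaps.

Import GRing.Theory FinRing.Theory.
Local Open Scope group_scope.
Local Open Scope ring_scope.

Variable M : finZmodType.
Implicit Types (f T : {additive M -> M}) (V : {group M}) (x : M).

Definition ker_set f : {set M} := [set x | f x == 0].

Lemma ker_set_group_set f : group_set (ker_set f).
Proof.
apply/group_setP; split=> [|x y]; first by rewrite inE raddf0.
by rewrite !inE zmodMgE raddfD => /eqP-> /eqP->; rewrite addr0.
Qed.
Canonical ker_set_group f := Group (ker_set_group_set f).

Lemma additive_morphM f : {in [set: M] &, {morph f : x y / (x * y)%g}}.
Proof. by move=> x y _ _; apply: raddfD. Qed.

Lemma im_set_group_set f V : group_set (f @: V).
Proof.
apply/group_setP; split=> [|_ _ /imsetP[x Vx ->] /imsetP[y Vy ->]].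
  by apply/imsetP; exists 0; [exact: group1 | rewrite raddf0].
by apply/imsetP; exists (x + y); [exact: groupM | rewrite raddfD].
Qed.
Canonical im_set_group f V := Group (im_set_group_set f V).

Lemma card_ker_im f V : (#|V :&: ker_set f| * #|f @: V|)%N = #|V|.
Proof.
pose phi := Morphism (@additive_morphM f).
have kerE : ('ker phi)%g = ker_set f.
  by apply/setP=> x; rewrite !inE.
have -> : #|f @: V| = #|phi @* V|%g by rewrite morphimEsub ?subsetT.
rewrite card_morphim setTI kerE -indexgI.
by rewrite Lagrange // subsetIl.
Qed.

(** For i <= n, f^i(V) contains the kernel of f on V, because f^n(V) does; so
    the step from f^i(V) to f^(i+1)(V) divides the order by that of the kernel.
    In terms of Jordan blocks: all of them have size n+1. *)
Lemma card_nilpotent n f V :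
    f @: V \subset V -> (forall x, x \in V -> iter n.+1 f x = 0) ->
    V :&: ker_set f \subset iter n f @: V ->
  #|V| = (#|V :&: ker_set f| ^ n.+1)%N.
Proof.
move=> fV fn0 kerV.
have fS (W : {set M}) i : iter i.+1 f @: W = f @: (iter i f @: W).
  by rewrite -imset_comp; apply: eq_imset.
have imX i : iter i f @: V \subset V.
  elim: i => [|i IHi]; first by rewrite imset_id.
  by rewrite fS (subset_trans _ fV) ?imsetS.
have im_grp i : group_set (iter i f @: V).
  elim: i => [|i IHi]; first by rewrite imset_id groupP.
  by rewrite fS; apply: (im_set_group_set f (Group IHi)).
have im_anti i : (i <= n)%N -> iter n f @: V \subset iter i f @: V.
  move=> le_in; rewrite -(subnKC le_in).
  apply/subsetP=> _ /imsetP[x Vx ->]; rewrite iterD.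
  by rewrite imset_f // (subsetP (imX (n - i)%N)) ?imset_f.
have step i : (i <= n.+1)%N -> #|V| = (#|V :&: ker_set f| ^ i * #|iter i f @: V|)%N.
  elim: i => [|i IHi] le_in; first by rewrite imset_id mul1n.
  rewrite {1}IHi ?(ltnW le_in) // -(card_ker_im f (Group (im_grp i))) /= -fS.
  rewrite expnSr mulnA; congr (_ * #|pred_of_set _| * _)%N.
  apply/eqP; rewrite eqEsubset setSI ?imX //= subsetI subsetIr andbT.
  by rewrite (subset_trans kerV) ?im_anti.
have im0 : iter n.+1 f @: V = [set 0].
  apply/setP=> y; rewrite inE; apply/imsetP/eqP=> [[x Vx ->]|->].
    exact: fn0.
  by exists 0; rewrite ?fn0 ?group1.
by rewrite (step n.+1) // im0 cards1 muln1.
Qed.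

Lemma iter_shift f T n x : (forall y, f y = y + T y) ->
  iter n f x = \sum_(i < n.+1) iter i T x *+ 'C(n, i).
Proof.
move=> fE; elim: n => [|n IHn]; first by rewrite big_ord1 /= mulr1n.
rewrite iterS IHn fE raddf_sum /= [RHS]big_ord_recl /= bin0 mulr1n.
under [in RHS]eq_bigr => i _ do rewrite binS mulrnDr.
rewrite big_split /= addrA; congr (_ + _); last first.
  by apply: eq_bigr => i _; rewrite raddfMn.
rewrite big_ord_recl bin0 mulr1n; congr (_ + _).
by rewrite big_ord_recr /= bin_small // mulr0n addr0.
Qed.

Lemma sum_iter_shift f T n x : (forall y, f y = y + T y) ->
  \sum_(i < n) iter i f x = \sum_(i < n) iter i T x *+ 'C(n, i.+1).
Proof.
move=> fE; elim: n => [|n IHn]; first by rewrite !big_ord0.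
rewrite big_ord_recr IHn (iter_shift _ _ fE) /=.
under [in RHS]eq_bigr => i _ do rewrite binS mulrnDr.
rewrite big_split /=; congr (_ + _).
by rewrite big_ord_recr /= bin_small // mulr0n addr0.
Qed.

(** The expansion of 1 + f + ... + f^(p-1) in powers of T = f - 1 has the
    coefficients 'C(p, i+1), all divisible by p but the last one, which is 1. *)
Lemma sum_iter_prime p f T x : prime p -> (forall y : M, y *+ p = 0) ->
    (forall y, f y = y + T y) ->
  \sum_(i < p) iter i f x = iter p.-1 T x.
Proof.
case: p => // p p_pr pM0 fE; rewrite (sum_iter_shift _ _ fE) big_ord_recr /=.
rewrite binn mulr1n big1 ?add0r // => i _.
have /dvdnP[m ->] : (p.+1 %| 'C(p.+1, i.+1))%N.
  by rewrite prime_dvd_bin //= ltnS ltn_ord.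
by rewrite mulrnA pM0.
Qed.

Definition mulp p x := x *+ p.

Lemma mulp_zmod p : zmod_morphism (mulp p).
Proof. by move=> x y; apply: mulrnBl. Qed.
HB.instance Definition _ p :=
  GRing.isZmodMorphism.Build M M (mulp p) (mulp_zmod p).

Definition torsion p := ker_set (mulp p).

Lemma torsionP p x : reflect (x *+ p = 0) (x \in torsion p).
Proof. by rewrite inE; apply: eqP. Qed.

Lemma torsion_abelem p : prime p -> (p.-abelem (torsion p))%g.
Proof.
move=> p_pr; apply/(abelemP p_pr); split=> [|x /torsionP]; last by [].
exact: zmod_abelian.
Qed.

End AdditiveMaps.

(** * Norms and fixed points *)

Section Norm.

Import GRing.Theory FinRing.Theory.
Local Open Scope group_scope.
Local Open Scope ring_scope.

Variables (E : finGroupType) (M : finZmodType).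
Variable to : groupAction [set: E] [set: M].
Implicit Types (A : {set E}) (H K : {group E}) (g h : E) (x y : M).

Lemma endo1 x : endo to 1 x = x.
Proof. exact: act1. Qed.

Lemma endoM g h x : endo to (g * h) x = endo to h (endo to g x).
Proof. by rewrite /endo actMin ?inE. Qed.

Lemma endoX g n x : endo to (g ^+ n) x = iter n (endo to g) x.
Proof. by elim: n => [|n IHn]; rewrite ?endo1 // expgSr endoM IHn. Qed.

Lemma fixedP A x :
  reflect (forall a, a \in A -> endo to a x = x) (x \in 'C_(|to)(A)).
Proof. by rewrite gacentE ?subsetT // setTI; apply: afixP. Qed.

Lemma fixed1P g x : reflect (endo to g x = x) (x \in 'C_(|to)[g]).
Proof.
apply: (iffP (fixedP _ _)) => [-> //|gx a]; first exact: set11.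
by move/set1P->.
Qed.

Definition norm A x := \sum_(a in A) endo to a x.

Lemma norm_zmod A : zmod_morphism (norm A).
Proof.
by move=> x y; rewrite -sumrB; apply: eq_bigr => a _; rewrite raddfB.
Qed.
HB.instance Definition _ A :=
  GRing.isZmodMorphism.Build M M (norm A) (norm_zmod A).

Lemma norm_cycle g x : norm <[g]> x = \sum_(i < #[g]%g) iter i (endo to g) x.
Proof.
rewrite /norm; under [RHS]eq_bigr => i _ do rewrite -endoX.
have -> : <[g]>%g = [set (g ^+ i)%g | i : 'I_#[g]%g].
  apply/setP=> a; apply/idP/imsetP=> [/cyclePmin[i lt_ig ->]|[i _ ->]].
    by exists (Ordinal lt_ig).
  exact: mem_cycle.
rewrite big_imset //= => i j _ _ /eqP.
by rewrite eq_expg_mod_order !modn_small // => /eqP/val_inj.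
Qed.

Lemma norm_dprod K H (G : {group E}) x :
  (K \x H = G)%g -> norm G x = norm H (norm K x).
Proof.
move=> defG; rewrite /norm (reindex_dprod defG) exchange_big /=.
apply: eq_bigr => h _; rewrite raddf_sum.
by apply: eq_bigr => k _; rewrite endoM.
Qed.

Lemma norm_fixed H x :
  x \in 'C_(|to)(H) -> norm H x = x *+ #|H|.
Proof.
move=> /fixedP Hx; rewrite /norm.
by rewrite (eq_bigr (fun=> x)) ?sumr_const // => a Ha; apply: Hx.
Qed.

Lemma norm_im_fixed H x : norm H x \in 'C_(|to)(H).
Proof.
apply/fixedP=> a Ha; rewrite /norm raddf_sum.
rewrite [RHS](reindex_inj (mulIg a)); apply: eq_big => b.
  by rewrite groupMr.
by move=> _; rewrite endoM.
Qed.

(** An equivariant function on H^1 is determined by its value at 1, which is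
    arbitrary.  It is a 0-cocycle when it is constant, hence when this value is
    fixed by H, and the 0-coboundaries are the constant functions whose value
    is a norm. *)
Lemma tate0_norm H :
  tate_cohomology to H 0 = 1%g -> norm H @: [set: M] = 'C_(|to)(H).
Proof.
move=> H0; apply/eqP; rewrite eqEsubset; apply/andP; split.
  by apply/subsetP=> _ /imsetP[x _ ->]; apply: norm_im_fixed.
apply/subsetP=> x /fixedP Hx.
have sZB : tate_cocycles to H 0 \subset tate_coboundaries to H 0.
  have cMM := zmod_abelian [set: {ffun {ffun 'I_1 -> subg_of H} -> M}].
  rewrite -quotient_sub1; last first.
    by rewrite cents_norm ?(sub_abelian_cent2 cMM) ?subsetT.
  by rewrite -/(tate_cohomology to H 0) H0.
pose c : {ffun {ffun 'I_1 -> subg_of H} -> M} := [ffun=> x].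
have Zc : c \in tate_cocycles to H 0.
  apply/setIdP; split.
    by apply/equivariantP=> t a; rewrite !ffunE Hx ?subgP.
  apply/eqP/ffunP=> t; rewrite !ffunE !big_ord_recl big_ord0 !ffunE addr0.
  by rewrite expr0 expr1 mulrNz subrr.
have /imsetP[f /equivariantP ef cE] := subsetP sZB _ Zc.
pose t1 : {ffun 'I_1 -> subg_of H} := [ffun=> 1%g].
apply/imsetP; exists (f t1) => //.
have <- : c t1 = x by rewrite ffunE.
rewrite cE ffunE /norm.
rewrite (reindex (fun t : {ffun 'I_1 -> subg_of H} => sgval (t ord0))) /=.
  apply: eq_big => t; first by rewrite subgP.
  move=> _; rewrite -ef; congr (f _); apply/ffunP=> i.
  by rewrite !ffunE mul1g (ord1 i).
exists (fun a => [ffun=> subg H a]) => [t _|a Ha]; last by rewrite ffunE subgK.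
by apply/ffunP=> i; rewrite ffunE sgvalK (ord1 i).
Qed.

End Norm.

(** * Elementary abelian groups with trivial cohomology in degree 0 *)

Section TrivialTate.

Import GRing.Theory FinRing.Theory.
Local Open Scope group_scope.
Local Open Scope ring_scope.

Variables (p : nat) (E : finGroupType) (M : finZmodType).
Variable to : groupAction [set: E] [set: M].
Hypothesis p_pr : prime p.
Hypothesis abelE : (p.-abelem [set: E])%g.
Hypothesis pM : (p.-group [set: M])%g.
Hypothesis norm_onto : forall H : {group E}, norm to H @: [set: M] = 'C_(|to)(H).
Implicit Types (H K : {group E}) (g h : E) (x y : M).

Lemma endoC g h x : endo to g (endo to h x) = endo to h (endo to g x).
Proof.
have cEE := abelem_abelian abelE.
by rewrite -!endoM (centsP cEE g _ h) ?inE.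
Qed.

Lemma order_notin H h : h \notin H -> #[h]%g = p.
Proof.
move=> H'h; apply: (abelem_order_p abelE); rewrite ?inE //.
by apply: contraNneq H'h => ->; apply: group1.
Qed.

Lemma dprod_notin H h : h \notin H -> (H \x <[h]> = H <*> <[h]>)%g.
Proof.
move=> H'h; rewrite dprodEY //.
  by rewrite (sub_abelian_cent2 (abelem_abelian abelE)) ?subsetT.
by rewrite setIC prime_TIg ?cycle_subG // -orderE (order_notin H'h).
Qed.

Lemma fixed_joing H h :
  'C_(|to)(H <*> <[h]>) = 'C_(|to)(H) :&: 'C_(|to)[h].
Proof.
by rewrite gacentY ?subsetT // -gacent_cycle ?in_setT.
Qed.

Lemma norm_fixed_joing H h : h \notin H ->
  norm to <[h]> @: 'C_(|to)(H) = 'C_(|to)(H <*> <[h]>).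
Proof.
move=> H'h; rewrite -(norm_onto H) -(norm_onto (H <*> <[h]>)) -imset_comp.
by apply: eq_imset => x /=; rewrite (norm_dprod _ _ (dprod_notin H'h)).
Qed.

Lemma fixed_nontrivial H : [set: M] != 1%g -> 'C_(|to)(H) != 1%g.
Proof.
move=> ntM; rewrite -[X in X != _]setTI.
have pH : (p.-group H)%g := pgroupS (subsetT H) (abelem_pgroup abelE).
exact: nontrivial_gacent_pgroup pH pM (gacts_range to (subsetT H)) ntM.
Qed.

(** Otherwise the norm of <[h]>, which maps the fixed points of H onto those of
    H x <[h]>, would be a surjective, hence injective, endomorphism of the
    fixed points of H.  But it would also be multiplication by p there, and
    these fixed points contain an element of order p. *)
Lemma fixed_not_sub H h : [set: M] != 1%g -> h \notin H ->
  ~~ ('C_(|to)(H) \subset 'C_(|to)[h]).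
Proof.
move=> ntM H'h; apply/negP=> sHh; set V := 'C_(|to)(H).
have [_ pV _] := pgroup_pdiv (pgroupS (subsetT V) pM) (fixed_nontrivial H ntM).
have imV : norm to <[h]> @: V = V.
  by rewrite norm_fixed_joing // fixed_joing (setIidPl sHh).
have [x Vx ox] := Cauchy p_pr pV.
have Nx0 : norm to <[h]> x = 0.
  have hx : x \in 'C_(|to)(<[h]>).
    by rewrite gacent_cycle ?in_setT //; apply: (subsetP sHh).
  by rewrite (norm_fixed hx) -orderE (order_notin H'h) -ox -zmodXgE expg_order.
have := card_ker_im (norm to <[h]>) [group of V].
rewrite /= imV => /eqP; rewrite -[eqbRHS]mul1n eqn_pmul2r ?cardG_gt0 //.
move/eqP/card1_trivg => ker1.
have : x \in V :&: ker_set (norm to <[h]>) by rewrite in_setI Vx inE; apply/eqP.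
by rewrite ker1 => /set1P x1; move: p_pr; rewrite -ox x1 order1.
Qed.

Lemma notin_cycle_sym g h : g != 1%g -> h \notin <[g]>%g -> g \notin <[h]>%g.
Proof.
move=> ntg g'h; have [_ _ _ tiHh] := dprodP (dprod_notin g'h).
apply: contra ntg => hg; apply/eqP/set1gP.
by rewrite -tiHh in_setI cycle_id.
Qed.

(** Subgroups of a cyclic p-group form a chain, while the fixed points of g and
    of h are incomparable by fixed_not_sub. *)
Lemma not_cyclic g h : [set: M] != 1%g -> g != 1%g -> h \notin <[g]>%g ->
  ~~ cyclic [set: M].
Proof.
move=> ntM ntg g'h; apply/negP=> cycM.
have h'g := notin_cycle_sym ntg g'h.
have nsub (a b : E) : b \notin <[a]>%g ->
    (logn p #|'C_(|to)[b]| < logn p #|'C_(|to)[a]|)%N.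
  move=> a'b; rewrite ltnNge; apply: contra (fixed_not_sub ntM a'b).
  have pC c := card_pgroup (pgroupS (subsetT 'C_(|to)[c]) pM).
  rewrite gacent_cycle ?in_setT // -(cardSg_cyclic cycM) ?subsetT //.
  by rewrite [X in (X %| _)%N]pC [X in (_ %| X)%N]pC dvdn_Pexp2l ?prime_gt1.
by have := ltn_trans (nsub _ _ g'h) (nsub _ _ h'g); rewrite ltnn.
Qed.

(** With T = h - 1, the norm of <[h]> is T^(p-1).  It maps the fixed points of
    H onto the kernel of T among them, and card_nilpotent applies. *)
Lemma card_fixed_step H h : (forall x, x *+ p = 0) -> h \notin H ->
  #|'C_(|to)(H)| = (#|'C_(|to)(H <*> <[h]>)| ^ p)%N.
Proof.
move=> pM0 H'h; pose T : {additive M -> M} := endo to h \- idfun.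
have TE y : endo to h y = y + T y by rewrite /= addrC subrK.
have sumT x : norm to <[h]> x = iter p.-1 T x.
  by rewrite norm_cycle (order_notin H'h) (sum_iter_prime _ p_pr pM0 TE).
have kerT : 'C_(|to)(H) :&: ker_set T = 'C_(|to)(H <*> <[h]>).
  rewrite fixed_joing; congr (_ :&: _); apply/setP=> x.
  by apply/idP/fixed1P; rewrite inE subr_eq0 => /eqP.
have p1 : p.-1.+1 = p by rewrite prednK ?prime_gt0.
rewrite -kerT -[in RHS]p1; apply: (card_nilpotent (V := [group of 'C_(|to)(H)])).
- apply/subsetP=> _ /imsetP[x /fixedP Hx ->]; apply/fixedP=> a Ha.
  by rewrite /= raddfB /= endoC Hx.
- move=> x _; rewrite iterS -sumT /=; apply/eqP; rewrite subr_eq0; apply/eqP.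
  by have /fixedP-> := norm_im_fixed to <[h]> x; rewrite ?cycle_id.
by rewrite kerT -(norm_fixed_joing H'h) (eq_imset _ sumT).
Qed.

(** Each step of a chain of subgroups from 1 to H, of index p, is an instance of
    card_fixed_step. *)
Lemma card_fixed H : (forall x, x *+ p = 0) ->
  #|[set: M]| = (#|'C_(|to)(H)| ^ #|H|)%N.
Proof.
move=> pM0; move: {2}#|H|.+1 (ltnSn #|H|) => n.
elim: n => // n IHn in H *; rewrite ltnS => leHn.
have [<-|[K maxK _]] := maximal_exists (sub1G H).
  rewrite cards1 expn1; congr #|pred_of_set _|; apply/esym/setP=> x.
  by rewrite in_setT; apply/fixedP=> a /set1gP->; apply: endo1.
have pH : (p.-group H)%g := pgroupS (subsetT H) (abelem_pgroup abelE).
have /maxgroupP[/properP[sKH [h Hh K'h]] maxKH] := maxK.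
have defH : (K <*> <[h]>)%g = H.
  apply/eqP/negPn/negP=> neqH; case/negP: (K'h).
  rewrite -(maxKH (K <*> <[h]>)%G) ?joing_subl //.
    by rewrite -cycle_subG joing_subr.
  by rewrite properEneq neqH join_subG sKH cycle_subG.
have iKH := p_maximal_index pH maxK.
rewrite (IHn K) ?(leq_trans (proper_card (maxgroupp maxK))) //.
by rewrite (card_fixed_step pM0 K'h) defH -expnM -iKH mulnC Lagrange.
Qed.

(** Let y <> 0 in M[p] be fixed by E, and let x in M[p] be outside the line of
    y.  The orbit of x misses 0, so it has less than p^2 elements and some
    g <> 1 fixes x.  Then g fixes x and y, which generate M[p]. *)
Lemma trivial_on_torsion :
    #|torsion M p| = (p ^ 2)%N -> (p ^ 2 <= #|[set: E]|)%N ->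
  exists2 g : E, g != 1%g & torsion M p \subset 'C_(|to)[g].
Proof.
move=> tor2 leE; set S := torsion M p.
have actS : [acts [set: E], on S | to].
  apply/actsP=> a _ x.
  have act_tor b y : y \in S -> endo to b y \in S.
    by move=> /torsionP Sy; apply/torsionP; rewrite -raddfMn Sy raddf0.
  apply/idP/idP=> [/(act_tor a^-1%g)|/(act_tor a)] //.
  by rewrite /endo actKin ?inE.
have pE := abelem_pgroup abelE.
have [y [Sy fixy nty]] : exists y, [/\ y \in S, y \in 'C_(|to)([set: E]) & y != 0].
  have pS := abelem_pgroup (torsion_abelem M p_pr).
  have ntS : S != 1%g.
    by rewrite trivg_card1 tor2 gtn_eqF // (ltn_exp2l 0) ?prime_gt1.
  have actS' : {acts [set: E], on group [group of S] | to} by split; rewrite ?subsetT.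
  have /trivgPn[y /setIP[Sy fixy] nty] := nontrivial_gacent_pgroup pE pS actS' ntS.
  by exists y; split; rewrite // gacentE ?subsetT // in_setI inE.
have [x Sx y'x] : exists2 x, x \in S & x \notin <[y]>%g.
  apply/subsetPn; apply/negP=> /subset_leq_card.
  rewrite tor2 -orderE (abelem_order_p (torsion_abelem M p_pr) Sy nty).
  by rewrite leqNgt ltn_Pmull ?prime_gt0 ?prime_gt1.
have [g gx ntg] : exists2 g, g \in 'C_[set: E][x | to]%g & g != 1%g.
  apply/trivgPn; apply: contraTneq leE => stab1.
  have := card_orbit_in_stab to x (subxx [set: E]).
  rewrite stab1 cards1 muln1 => <-; rewrite -ltnNge -tor2.
  apply/proper_card/properP; split; first by rewrite acts_sub_orbit.
  (* The point of M[p] outside the orbit. *)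
  exists 0; first exact: group1.
  apply: contra y'x => /orbitP[a _ ax].
  rewrite -[x](actKin to (in_setT a)) ax.
  by have -> : to 0 a^-1%g = 0 := raddf0 (endo to a^-1%g); apply: group1.
exists g => //; apply/setIidPl/eqP; rewrite eqEcard subsetIl -/S tor2 /=.
set K := [group of S :&: 'C_(|to)[g]].
have Ky : y \in K.
  by rewrite in_setI Sy; apply/fixed1P; have /fixedP-> := fixy; rewrite ?in_setT.
have Kx : x \in K.
  by rewrite in_setI Sx; apply/fixed1P; case/setIP: gx => _ /astab1P.
have ltpK : (p < #|K|)%N.
  rewrite -(abelem_order_p (torsion_abelem M p_pr) Sy nty) orderE.
  apply/proper_card/properP; split; first by rewrite cycle_subG.
  by exists x.
have pK : (p.-group K)%g := pgroupS (subsetT K) pM.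
move: ltpK; rewrite -/(gval K) (card_pgroup pK) -{1}[p]expn1.
have p_gt1 := prime_gt1 p_pr.
by rewrite !leq_exp2l // ltn_exp2l.
Qed.

Section RankTwo.

Hypothesis tor2 : #|torsion M p| = (p ^ 2)%N.
Variable g : E.
Hypothesis ntg : g != 1%g.
Hypothesis g_tor : torsion M p \subset 'C_(|to)[g].

Let order_g : #[g]%g = p.
Proof. by rewrite (abelem_order_p abelE) ?inE. Qed.

Lemma fixed_cycle h : 'C_(|to)(<[h]>) = 'C_(|to)[h].
Proof. by rewrite gacent_cycle ?in_setT. Qed.

Lemma norm_torsion x : x \in torsion M p -> norm to <[g]> x = 0.
Proof.
move=> tor_x; rewrite norm_fixed -?orderE ?order_g; first exact/torsionP.
by rewrite fixed_cycle (subsetP g_tor).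
Qed.

(** The norm of <[g]> kills M[p], so its image, which is the group of fixed
    points of g, would be generated by the norm of x.  A cyclic group does not
    contain M[p]. *)
Lemma not_cyclic_mod_torsion x :
  ~ (forall y, exists n, y - x *+ n \in torsion M p).
Proof.
move=> gen_x; pose z := norm to <[g]> x.
have sub_z : torsion M p \subset <[z]>%g.
  apply: (subset_trans g_tor); rewrite -fixed_cycle -norm_onto.
  apply/subsetP=> _ /imsetP[y _ ->]; have [n /norm_torsion] := gen_x y.
  rewrite raddfB raddfMn => /eqP; rewrite subr_eq0 => /eqP->.
  exact: (mem_cycle z n).
have := cyclicS sub_z (cycle_cyclic z).
by rewrite (abelem_cyclic (torsion_abelem M p_pr)) tor2 pfactorK.
Qed.

End RankTwo.

(** Comparing orders, M[2] is at once the set of fixed points of g, the kernel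
    of N_g = 1 + g and the image of multiplication by 2.  By fixed_not_sub, h
    moves some x in M[2]; then y = x^h - x is the only nonzero fixed point of h
    in M[2].  Write y = 2u.  The element w = u^g - u of M[2] is fixed by h, as
    g and h commute and g is trivial on M[2], so w is 0 or y.  In the first
    case u is fixed by g; in the second u^g = 3u, so N_g u = 4u = 0.  Either
    way u is in M[2], which contradicts 2u = y <> 0. *)
Lemma not_order16_exponent4 g h : p = 2%N -> #|[set: M]| = 16%N -> #|torsion M 2| = 4%N ->
  g != 1%g -> torsion M 2 \subset 'C_(|to)[g] -> h \notin <[g]>%g ->
  (forall x, x *+ 4 = 0) -> False.
Proof.
move=> p2 cardM card_tor ntg g_tor g'h M4.
pose S := torsion M 2; pose N := norm to <[g]>.
have tor2 : #|torsion M p| = (p ^ 2)%N by rewrite p2.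
have order_g : #[g]%g = 2 by rewrite (abelem_order_p abelE) ?inE.
have NE x : N x = x + endo to g x.
  by rewrite /N norm_cycle order_g !big_ord_recl big_ord0 addr0.
have kerS : S \subset ker_set (norm to <[g]>).
  apply/subsetP=> x Sx; rewrite inE; apply/eqP.
  by apply: norm_torsion; rewrite ?p2.
have cardN := card_ker_im (norm to <[g]>) [group of [set: M]].
rewrite /= setTI norm_onto gacent_cycle ?in_setT // cardM in cardN.
have le_ker := subset_leq_card kerS; have le_fix := subset_leq_card g_tor.
rewrite card_tor in le_ker le_fix.
(* Both factors of cardN are at least 4 and their product is 16. *)
have fixS : 'C_(|to)[g] = S.
  apply/esym/eqP; rewrite eqEcard g_tor card_tor -(leq_pmul2l (isT : 0 < 4)%N).
  by rewrite -[X in (_ <= X)%N]cardN leq_pmul2r // (leq_trans _ le_fix).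
have kerE : ker_set (norm to <[g]>) = S.
  apply/esym/eqP; rewrite eqEcard kerS card_tor.
  by rewrite -(leq_pmul2r (isT : 0 < 4)%N) -[X in (_ * X)%N]card_tor -/S -fixS cardN.
have imS : mulp 2 @: [set: M] = S.
  apply/eqP; rewrite eqEcard; apply/andP; split.
    by apply/subsetP=> _ /imsetP[x _ ->]; apply/torsionP; rewrite -mulrnA M4.
  have := card_ker_im (mulp 2) [group of [set: M]].
  rewrite /= setTI -/(torsion M 2) card_tor cardM => im16.
  by rewrite -(leq_pmul2l (isT : 0 < 4)%N) im16.
have fixg x : x \in S -> endo to g x = x by move=> Sx; apply/fixed1P; rewrite fixS.
have ntM : [set: M] != 1%g by rewrite trivg_card1 cardM.
have := fixed_not_sub ntM g'h; rewrite gacent_cycle ?in_setT // fixS.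
case/subsetPn=> x Sx /fixed1P nhx; pose y := endo to h x - x.
have endoS a z : z \in S -> endo to a z \in S.
  by move=> /torsionP Sz; apply/torsionP; rewrite -raddfMn Sz raddf0.
have Sy : y \in S.
  have tor0 z (Sz : z \in S) : z *+ 2 = 0 := torsionP 2 z Sz.
  by apply/torsionP; rewrite mulrnBl !tor0 ?subrr ?endoS.
have hh z : endo to h (endo to h z) = z.
  rewrite -endoM -[(h * h)%g]/(h ^+ 2)%g -{1}p2.
  by rewrite -(order_notin g'h) expg_order endo1.
have oppS z : z \in S -> - z = z.
  by move=> /torsionP z0; apply/eqP; rewrite eq_sym -addr_eq0 -mulr2n z0.
have hy : endo to h y = y.
  by rewrite {1}/y raddfB /= hh -opprB oppS.
have y0 : y != 0 by rewrite subr_eq0; apply/eqP.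
have fixhS w : w \in S -> endo to h w = w -> w = 0 \/ w = y.
  move=> Sw hw; pose K := [group of S :&: 'C_(|to)[h]].
  have : (#|K| < 4)%N.
    rewrite -card_tor; apply/proper_card/properP; split; first exact: subsetIl.
    by exists x; rewrite // in_setI Sx; apply/fixed1P.
  have Ky : y \in K by rewrite in_setI Sy; apply/fixed1P.
  have Kw : w \in K by rewrite in_setI Sw; apply/fixed1P.
  have dvK : (#|K| %| 4)%N by rewrite -card_tor cardSg ?subsetIl.
  have sub3 : [set 0; y; w] \subset K.
    by rewrite !subUset !sub1set Ky Kw !andbT; apply: group1.
  (* If 0, y and w were distinct, h would fix at least 3 of the 4 points. *)
  move=> ltK; have [->|w0] := eqVneq w 0; [by left | right; apply/eqP].
  have := subset_leq_card sub3; apply: contraTT => wy.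
  rewrite -ltnNge setUC cardsU1 !inE (negPf w0) (negPf wy) cards2 eq_sym y0.
  by case: #|_| ltK dvK => [|[|[|[|]]]].
have [u _ yu] : exists2 u, u \in [set: M] & y = mulp 2 u by apply/imsetP; rewrite imS.
pose t := endo to h u - u; pose w := endo to g u - u.
have St : t \in S by apply/torsionP; rewrite mulrnBl -raddfMn /= -[u *+ 2]yu hy subrr.
have Sw : w \in S.
  by apply/torsionP; rewrite mulrnBl -raddfMn /= -[u *+ 2]yu fixg ?subrr.
have hw : endo to h w = w.
  have hu : endo to h u = u + t by rewrite addrC subrK.
  rewrite /w raddfB /= -endoC hu raddfD /= (fixg t St).
  by rewrite opprD addrACA subrr addr0.
have Su : u \in S.
  have [w0|wy] := fixhS w Sw hw.
    by rewrite -fixS; apply/fixed1P/eqP; rewrite -subr_eq0 -/w w0.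
  rewrite -kerE inE; apply/eqP; rewrite [LHS]NE.
  have -> : endo to g u = u + u *+ 2 by rewrite -[u *+ 2]yu -wy addrC subrK.
  by rewrite addrA -mulr2n -mulrnDr M4.
by move: y0; rewrite yu /mulp (torsionP _ _ Su) eqxx.
Qed.

End TrivialTate.

(** * Torsion in products of cyclic groups *)

Section TorsionOfGroups.

Import GRing.Theory FinRing.Theory.
Local Open Scope group_scope.

Lemma card_Ldiv_Zp p k : prime p -> 0 < k ->
  #|'Ldiv_p([set: 'Z_(p ^ k)])| = p.
Proof.
move=> p_pr k_gt0; have p_gt1 := prime_gt1 p_pr.
have pk_gt1 : 1 < p ^ k by rewrite -{1}(expn0 p) ltn_exp2l.
have cardZ : #|[set: 'Z_(p ^ k)]| = (p ^ k)%N by rewrite cardsT card_ord Zp_cast.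
have cycZ : cyclic [set: 'Z_(p ^ k)] by rewrite Zp_cycle cycle_cyclic.
have pZ : p.-group [set: 'Z_(p ^ k)] by rewrite /pgroup cardZ pnatX pnat_id.
rewrite -[RHS](Ohm1_cyclic_pgroup_prime cycZ pZ).
  by rewrite (OhmEabelian pZ) ?zmod_abelian // expn1.
by rewrite trivg_card1 cardZ neq_ltn pk_gt1 orbT.
Qed.

Lemma expg_pair (aT bT : finGroupType) (a : aT) (b : bT) n :
  (a, b) ^+ n = (a ^+ n, b ^+ n).
Proof. by elim: n => // n IHn; rewrite !expgS IHn. Qed.

Lemma card_Ldiv_prod (aT bT : finGroupType) n :
  #|'Ldiv_n([set: aT * bT])| =
    (#|'Ldiv_n([set: aT])| * #|'Ldiv_n([set: bT])|)%N.
Proof.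
rewrite -cardsX; congr #|pred_of_set _|; apply/setP=> -[a b].
by rewrite !inE expg_pair.
Qed.

Lemma card_torsion_isog (M : finZmodType) (gT : finGroupType) p :
  [set: M] \isog [set: gT] -> #|torsion M p| = #|'Ldiv_p([set: gT])|.
Proof.
case/isogP=> f injf imf; rewrite -(card_injm injf (subsetT _)).
rewrite morphimEsub ?subsetT //; congr #|pred_of_set _|; apply/setP=> y.
rewrite setTI inE; apply/imsetP/eqP=> [[x /torsionP x0 ->]|y0].
  by rewrite -morphX ?in_setT // zmodXgE x0 morph1.
have : y \in f @* [set: M] by rewrite imf in_setT.
case/morphimP=> x Tx _ defy; exists x => //; apply/torsionP.
by apply: (injmP injf); rewrite ?in_setT // -zmodXgE morphX // -defy y0 morph1.
Qed.

Lemma expg_Zp n (a : 'Z_n) : 1 < n -> a ^+ n = 1.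
Proof. by move=> n1; rewrite zmodXgE -mulr_natr pchar_Zp // mulr0. Qed.

Lemma isog_torsion (M : finZmodType) (gT : finGroupType) n :
    (forall y : gT, y ^+ n = 1) -> [set: M] \isog [set: gT] ->
  forall x : M, (x *+ n = 0)%R.
Proof.
move=> gTn /isogP[f injf _] x; apply: (injmP injf); rewrite ?in_setT //.
by rewrite -zmodXgE morphX ?in_setT // gTn morph1.
Qed.

(** The generator of the first factor gives x, as the second factor is killed
    by p. *)
Lemma cyclic_mod_torsion (M : finZmodType) n p : 1 < p ->
    [set: M] \isog [set: 'Z_n * 'Z_p] ->
  exists x : M, forall y, exists k, (y - x *+ k)%R \in torsion M p.
Proof.
move=> p_gt1 /isogP[f injf imf].
have fK (z : 'Z_n * 'Z_p) : exists x : M, f x = z.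
  have : z \in f @* [set: M] by rewrite imf in_setT.
  by case/morphimP=> x _ _ ->; exists x.
have [x fx] := fK (1%R, 1).
exists x => y; exists (f y).1 => /=; apply/torsionP.
apply: (injmP injf); rewrite ?in_setT // -zmodXgE -zmodMgE -zmodVgE.
rewrite -zmodXgE morphX ?in_setT // morphM ?in_setT // morphV ?in_setT //.
rewrite morphX ?in_setT // fx morph1; case: (f y) => a b /=.
rewrite (expg_pair (1%R : 'Z_n) (1 : 'Z_p)) expg1n zmodXgE natr_Zp.
rewrite -[_ * _^-1]/(a * a^-1, b * 1^-1) mulgV expg_pair expg1n.
by rewrite expg_Zp.
Qed.

End TorsionOfGroups.

(** * The theorem *)

Theorem mainTheorem2 (p r : nat) (E : finGroupType) (M : finZmodType)
    (to : groupAction [set: E] [set: M]) :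
  prime p ->
  (p.-abelem [set: E])%g ->
  'r([set: E])%g = r ->
  2 <= r ->
  (p.-group [set: M])%g ->
  ([faithful [set: E], on [set: M] | to])%g ->
  cohomologically_trivial to ->
  [/\ ~~ cyclic [set: M],
      forall k : nat, 2 <= k -> ~~ ([set: M] \isog [set: 'Z_(p ^ k) * 'Z_p]),
      forall k : nat, [set: M] \isog [set: 'rV['Z_p]_k] -> p ^ r %| k
    & p = 2 -> ~~ ([set: M] \isog [set: 'Z_4 * 'Z_4])].
Proof.
move=> p_pr abelE rE r_ge2 pM faithM triv.
have normE (H : {group E}) : (norm to H @: [set: M] = 'C_(|to)(H))%g.
  by apply: tate0_norm; apply: triv.
have p_gt1 := prime_gt1 p_pr.
have cardE : #|[set: E]| = p ^ r.
  by rewrite -rE (rank_abelem abelE) -card_pgroup ?abelem_pgroup.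
have leE : p ^ 2 <= #|[set: E]| by rewrite cardE leq_exp2l.
have lt_cycle (g : E) : exists h, h \notin <[g]>%g.
  have /subsetPn[h _ g'h] : ~~ ([set: E] \subset <[g]>)%g; last by exists h.
  apply: contraL leE => /subset_leq_card le_g; rewrite -ltnNge.
  apply: leq_ltn_trans le_g _; rewrite -orderE.
  have [->|ntg] := eqVneq g 1%g; first by rewrite order1 -{1}(expn0 p) ltn_exp2l.
  by rewrite (abelem_order_p abelE) ?inE // -{1}[p]expn1 ltn_exp2l.
have [g ntg] : exists g : E, g != 1%g.
  have [g nt_g] := lt_cycle 1%g; exists g.
  by apply: contraNneq nt_g => ->; rewrite group1.
have ntM : [set: M] != 1%g.
  apply: contraNneq ntg => M1; apply/eqP/set1gP.
  apply/set1P; rewrite (faithfulP faithM g) ?in_setT // => x.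
  have /set1gP-> : x \in [1 M]%g by rewrite -M1 in_setT.
  by move=> _; apply: (GRing.raddf0 (endo to g)).
have M_Zp k m : 0 < k -> 0 < m -> [set: M] \isog [set: 'Z_(p ^ k) * 'Z_(p ^ m)] ->
    #|torsion M p| = p ^ 2.
  move=> k_gt0 m_gt0 /card_torsion_isog->.
  by rewrite card_Ldiv_prod !card_Ldiv_Zp.
split.
- have [h g'h] := lt_cycle g.
  exact: (not_cyclic p_pr abelE pM normE ntM ntg g'h).
- move=> k k_ge2; apply/negP=> isoM.
  have tor2 : #|torsion M p| = p ^ 2 by apply: (M_Zp k 1); rewrite ?expn1 // ltnW.
  have [g0 ntg0 g0_tor] := trivial_on_torsion to p_pr abelE pM tor2 leE.
  have [x gen_x] := cyclic_mod_torsion p_gt1 isoM.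
  exact: (not_cyclic_mod_torsion p_pr abelE normE tor2 ntg0 g0_tor gen_x).
- move=> k isoM.
  have pM0 : forall x : M, (x *+ p = 0)%R.
    apply: isog_torsion isoM => v.
    by rewrite FinRing.zmodXgE -GRing.scaler_nat pchar_Zp // GRing.scale0r.
  have := card_fixed p_pr abelE normE [group of [set: E]] pM0.
  rewrite (card_isog isoM) cardE cardsT card_mx mul1n card_ord Zp_cast //.
  rewrite (card_pgroup (pgroupS (subsetT 'C_(|to)([set: E])%g) pM)) -expnM.
  by move/eqP; rewrite eqn_exp2l // => /eqP->; rewrite dvdn_mull.
- move=> p2; apply/negP=> isoM; subst p.
  have tor2 := M_Zp 2 2 isT isT isoM.
  have [g0 ntg0 g0_tor] := trivial_on_torsion to p_pr abelE pM tor2 leE.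
  have [h g'h] := lt_cycle g0.
  apply: (not_order16_exponent4 p_pr abelE pM normE (erefl 2) _ tor2 ntg0 g0_tor g'h) => //.
    by rewrite (card_isog isoM) cardsT card_prod !card_ord.
  apply: isog_torsion isoM => -[a b].
  by rewrite expg_pair !expg_Zp.
Qed.
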